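(* Let $k\ge 1$ and $p\ge 1$ be integers and let $b\in\mathbb{R}^k$. Consider the problem of minimizing $b^{\top}x$ over all $x\in\mathcal{S}^{k-1}\cap\mathbb{R}^k_+\cap M_p^k$. Put $b^+=\max\{b,0\}$ and $b^-=\max\{-b,0\}$, where the maxima are taken component-wise. Then an optimal solution is given by $$u=\begin{cases}\dfrac{b^-_p}{\|b^-_p\|}, & \text{if } b^-\ne 0,\\[2mm] e_{j_0}\ \text{ with } j_0\in\arg\min_j b_j, & \text{otherwise},\end{cases}$$ where $b^-_p$ is obtained from $b^-$ by keeping its $p$ largest components and setting the others to zero, and $b^-_p=b^-$ when $\|b^-\|_0\le p$.
   Context: $\mathcal{S}^{k-1}=\{x\in\mathbb{R}^k:\|x\|=1\}$ is the Euclidean unit sphere, $\mathbb{R}^k_+$ is the nonnegative orthant, $\|x\|_0$ is the number of nonzero components of $x$, $M_p^k=\{x\in\mathbb{R}^k:\|x\|_0\le p\}$, and $e_j$ is the $j$th standard unit vector of $\mathbb{R}^k$. Ties in selecting the $p$ largest components or the minimizing index are broken arbitrarily. *)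

(* Defs.v *)
From mathcomp Require Import all_boot all_order all_algebra.
From mathcomp Require Import classical_sets reals.
Set Implicit Arguments.
Unset Strict Implicit.
Unset Printing Implicit Defensive.

Import Order.TTheory GRing.Theory Num.Theory.

Local Open Scope classical_set_scope.
Local Open Scope ring_scope.

Section SparseSphere.
Variables (R : realType) (k : nat).
Implicit Types (p : nat) (b x u v w : 'cV[R]_k).

(* The norm that MathComp-Analysis puts on matrices is the max norm, so the
   Euclidean norm is defined here. *)
Definition enorm x : R := Num.sqrt (\sum_i x i 0 ^+ 2).

Definition nnz x : nat := #|[pred i | x i 0 != 0]|.

Definition sphere : set 'cV[R]_k := [set x | enorm x = 1].
Definition orthant : set 'cV[R]_k := [set x | forall i, 0 <= x i 0].
Definition sparse p : set 'cV[R]_k := [set x | (nnz x <= p)%N].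

Definition feasible p : set 'cV[R]_k := sphere `&` orthant `&` sparse p.

Definition objective b x : R := (b^T *m x) 0 0.

Definition optimal p b u : Prop :=
  feasible p u /\ forall x, feasible p x -> objective b u <= objective b x.

Definition neg_part b : 'cV[R]_k := \col_i Num.max (- b i 0) 0.

(* A relation and not a function: when several components tie for the p-th
   largest value, every admissible choice of the kept index set S counts. *)
Definition keeps_largest p v w : Prop :=
  if (nnz v <= p)%N then w = v
  else exists S : {set 'I_k},
    [/\ #|S| = p,
        forall i j, i \in S -> j \notin S -> v j 0 <= v i 0
      & w = \col_i (if i \in S then v i 0 else 0)].

Definition argmin b : set 'I_k := [set j0 | forall j, b j0 0 <= b j 0].

(* u is given by the closed formula, for some way of breaking the ties. *)
Definition closed_form p b u : Prop :=
  if neg_part b != 0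
  then exists2 w, keeps_largest p (neg_part b) w & u = (enorm w)^-1 *: w
  else exists2 j0, argmin b j0 & u = delta_mx j0 0.

End SparseSphere.

(* Main.v *)
Require Import Defs.
From mathcomp Require Import all_boot all_order all_algebra.
From mathcomp Require Import classical_sets reals.
From mathcomp Require Import ring lra.

(** Why the formula is optimal.  Let [v] be the negative part of [b], and let
    [x] be feasible with support [T], so that [T] has at most [p] elements.

    Suppose [v != 0], let [w] be [v] cut down to its [p] largest entries and
    let [s] be the norm of [w].  Since [- v <= b] and [x >= 0],
    [b^T x >= - \sum_(i in T) v_i x_i], and the Cauchy-Schwarz inequality on
    [T] bounds this below by minus the norm of [v] restricted to [T].  Among
    all sets of at most [p] indices, those carrying the largest entries of [v]
    have the largest sum of squares ([sum_le_sum_largest],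
    [sum_sqr_le_keeps_largest]), so [b^T x >= - s] ([objective_ge]).  On the
    support of [w] one has [b = - w], hence [b^T w = - s ^ 2], and [w / s]
    attains the bound.

    Suppose [v = 0], that is [b >= 0].  The entries of [x] lie in [[0, 1]], so
    [\sum_i x_i >= \sum_i x_i ^ 2 = 1] and [b^T x >= (min_j b_j) \sum_i x_i]
    is at least [min_j b_j], which a unit vector attains. *)

Set Implicit Arguments.
Unset Strict Implicit.
Unset Printing Implicit Defensive.

Import Order.TTheory GRing.Theory Num.Theory.

Local Open Scope ring_scope.

(** * Sums over the indices of the largest values *)

(** Subtract from [f] a threshold [c >= 0] that separates its values outside
    [S] from those on [S].  Then [f - c] is nonnegative on [S] and nonpositive
    off it, so [S] maximizes the sum of [f - c] over all sets whatsoever, and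
    adding [c] back favours the larger set. *)
Lemma sum_le_sum_largest (R : realDomainType) (I : finType) (f : I -> R)
    (S T : {set I}) :
  (forall i, 0 <= f i) -> (forall i j, i \in S -> j \notin S -> f j <= f i) ->
  (#|T| <= #|S|)%N -> \sum_(i in T) f i <= \sum_(i in S) f i.
Proof.
move=> f_ge0 largest leTS.
(* Starting the maximum at 0 makes [c] nonnegative; as [f] is nonnegative, [c]
   still lies below the values of [f] on [S]. *)
pose c := \big[Num.max/0]_(j | j \notin S) f j.
have c_ge0 : 0 <= c by apply: bigmax_ge_id.
have c_out j : j \notin S -> f j <= c by move=> jS; apply: le_bigmax_cond.
have c_in i : i \in S -> c <= f i.
  by move=> iS; apply/bigmax_leP; split=> // j; apply: largest.
have shifted : \sum_(i in T) (f i - c) <= \sum_(i in S) (f i - c).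
  rewrite big_mkcond [leRHS]big_mkcond; apply: ler_sum => i _.
  have [/c_in|/c_out] := boolP (i \in S); case: (i \in T) => ?; lra.
have leTSc : c *+ #|T| <= c *+ #|S| by apply: ler_wpMn2l.
move: shifted; rewrite !sumrB !sumr_const; lra.
Qed.

Lemma exists_largest_set (R : realDomainType) (I : finType) (f : I -> R)
    (p : nat) :
  (p <= #|I|)%N ->
  exists S : {set I},
    #|S| = p /\ (forall i j, i \in S -> j \notin S -> f j <= f i).
Proof.
move=> lepI; pose r i j := f j <= f i.
pose s := sort r (enum I).
have r_total : total r by move=> i j; apply: le_total.
have r_trans : transitive r by move=> j i l ij jl; apply: le_trans ij.
have size_s : size s = #|I| by rewrite size_sort -cardE.
have s_uniq : uniq s by rewrite sort_uniq enum_uniq.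
exists [set i in take p s]; split.
  rewrite cardsE; have /card_uniqP -> := take_uniq p s_uniq.
  by rewrite size_takel ?size_s.
move=> i j; rewrite !inE => iS jS.
have : pairwise r (take p s ++ drop p s).
  by rewrite cat_take_drop -sorted_pairwise // sort_sorted.
rewrite pairwise_cat => /andP[/allrelP r_cat _]; apply: r_cat => //.
have : j \in take p s ++ drop p s by rewrite cat_take_drop mem_sort mem_enum.
by rewrite mem_cat (negPf jS).
Qed.

(** * Objective, norm and negative part *)

Section Vectors.
Variables (R : realType) (k : nat).
Implicit Types (p : nat) (b x u v w : 'cV[R]_k).

Lemma objectiveE b x : objective b x = \sum_i b i 0 * x i 0.
Proof. by rewrite /objective mxE; apply: eq_bigr => i _; rewrite mxE. Qed.

Lemma enorm_ge0 x : 0 <= enorm x.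
Proof. exact: sqrtr_ge0. Qed.

Lemma sqr_enorm x : enorm x ^+ 2 = \sum_i x i 0 ^+ 2.
Proof. by rewrite sqr_sqrtr // sumr_ge0 // => i _; apply: sqr_ge0. Qed.

Lemma enorm_eq1 x : \sum_i x i 0 ^+ 2 = 1 -> enorm x = 1.
Proof. by rewrite /enorm => ->; rewrite sqrtr1. Qed.

Lemma sum_sqr_sphere x : sphere x -> \sum_i x i 0 ^+ 2 = 1.
Proof. by rewrite -sqr_enorm => ->; rewrite expr1n. Qed.

Lemma neg_part_ge0 b i : 0 <= neg_part b i 0.
Proof. by rewrite mxE le_max lexx orbT. Qed.

Lemma neg_part_ge b i : - b i 0 <= neg_part b i 0.
Proof. by rewrite mxE le_max lexx. Qed.

(** This makes [b] act as [- w] on the truncation [w] of its negative part, so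
    that the lower bound is attained there. *)
Lemma neg_part_mul b i : b i 0 * neg_part b i 0 = - neg_part b i 0 ^+ 2.
Proof. by rewrite mxE maxEle; case: ifP => _; ring. Qed.

(** * Keeping the largest entries *)

Lemma keeps_largest_exists p v : exists w, keeps_largest p v w.
Proof.
rewrite /keeps_largest; case: leqP => [_|ltp]; first by exists v.
have lepk : (p <= #|'I_k|)%N by apply: leq_trans (ltnW ltp) (max_card _).
have [S [cardS largest]] := exists_largest_set (fun i => v i 0) lepk.
by exists (\col_i (if i \in S then v i 0 else 0)), S.
Qed.

(** This form is independent of the index set chosen, and suffices to compute
    [b^T w] for [w] cut from the negative part of [b]. *)
Lemma keeps_largest_entry p v w i :
  keeps_largest p v w -> w i 0 = 0 \/ w i 0 = v i 0.
Proof.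
rewrite /keeps_largest; case: ifP => [_ ->|_ [S [_ _ ->]]]; first by right.
by rewrite mxE; case: ifP => _; [right|left].
Qed.

Lemma keeps_largest_sparse p v w : keeps_largest p v w -> sparse p w.
Proof.
rewrite /keeps_largest /sparse /=; case: ifP => [le_p ->|_ [S [<- _ ->]]] //.
apply: subset_leq_card; apply/fintype.subsetP=> i; rewrite inE mxE.
by case: ifP => //; rewrite eqxx.
Qed.

Lemma sum_sqr_le_keeps_largest p v w (T : {set 'I_k}) :
  (forall i, 0 <= v i 0) -> keeps_largest p v w -> (#|T| <= p)%N ->
  \sum_(i in T) v i 0 ^+ 2 <= \sum_i w i 0 ^+ 2.
Proof.
move=> v_ge0; rewrite /keeps_largest; case: ifP => [_ -> _|_].
  rewrite big_mkcond; apply: ler_sum => i _.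
  by case: ifP => // _; apply: sqr_ge0.
move=> [S [<- largest ->]] leTS.
have -> : \sum_i (\col_i (if i \in S then v i 0 else 0)) i 0 ^+ 2
          = \sum_(i in S) v i 0 ^+ 2.
  rewrite [RHS]big_mkcond; apply: eq_bigr => i _.
  by rewrite mxE; case: ifP => // _; rewrite expr0n.
apply: sum_le_sum_largest => // [i|i j iS jS]; first exact: sqr_ge0.
by rewrite lerXn2r ?nnegrE ?largest.
Qed.

(** As [p > 0], one nonzero entry of [v] is already an admissible index set,
    so [w] cannot vanish and can be normalized. *)
Lemma enorm_keeps_largest_gt0 p v w :
  (0 < p)%N -> (forall i, 0 <= v i 0) -> v != 0 -> keeps_largest p v w ->
  0 < enorm w.
Proof.
move=> p_gt0 v_ge0 v_neq0 vw.
have /cV0Pn[i vi] := v_neq0.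
have := @sum_sqr_le_keeps_largest p v w [set i] v_ge0 vw.
rewrite cards1 big_set1 => /(_ p_gt0) le_w.
by rewrite sqrtr_gt0; apply: lt_le_trans le_w; rewrite exprn_even_gt0 ?vi ?orbT.
Qed.

(** * The two cases of the closed formula *)

(** The Cauchy-Schwarz inequality enters through its arithmetic-geometric form
    [2 s v_i x_i <= v_i ^ 2 + s ^ 2 x_i ^ 2], with [s] the norm of [w]: summed
    over the support of [x], both terms on the right contribute at most
    [s ^ 2]. *)
Lemma objective_ge p b w x :
  keeps_largest p (neg_part b) w -> 0 < enorm w -> feasible p x ->
  - enorm w <= objective b x.
Proof.
move=> vw s_gt0 [[/sum_sqr_sphere x1 x_ge0] x_sparse].
set s := enorm w in s_gt0 *; set v := neg_part b in vw *.
pose T := [set i | x i 0 != 0].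
have cardT : (#|T| <= p)%N by rewrite cardsE.
have := sum_sqr_le_keeps_largest (neg_part_ge0 b) vw cardT.
rewrite -sqr_enorm -/s -/v big_mkcond => vT.
have amgm : \sum_i - ((if i \in T then v i 0 ^+ 2 else 0) + s ^+ 2 * x i 0 ^+ 2)
            <= \sum_i 2 * s * (b i 0 * x i 0).
  apply: ler_sum => i _; rewrite inE.
  have [->|_] /= := eqVneq (x i 0) 0; first by lra.
  have bvx : 0 <= s * ((b i 0 + v i 0) * x i 0).
    apply: mulr_ge0; first exact: ltW.
    apply: mulr_ge0; last exact: x_ge0.
    by have := neg_part_ge b i; rewrite -/v; lra.
  have := sqr_ge0 (v i 0 - s * x i 0); nra.
rewrite objectiveE -(ler_pM2l (_ : 0 < 2 * s)); last by lra.
rewrite [leRHS]mulr_sumr; apply: le_trans amgm.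
by rewrite sumrN big_split /= -mulr_sumr x1; nra.
Qed.

Lemma optimal_normalized_keeps_largest p b w :
  (0 < p)%N -> neg_part b != 0 -> keeps_largest p (neg_part b) w ->
  optimal p b ((enorm w)^-1 *: w).
Proof.
move=> p_gt0 b_neg vw; set v := neg_part b in b_neg vw.
have s_gt0 : 0 < enorm w.
  exact: enorm_keeps_largest_gt0 p_gt0 (neg_part_ge0 b) b_neg vw.
have s_neq0 : enorm w != 0 by rewrite gt_eqF.
have bw i : b i 0 * w i 0 = - w i 0 ^+ 2.
  by have [->|->] := keeps_largest_entry i vw; [ring|apply: neg_part_mul].
split; last first.
  move=> x /(objective_ge vw s_gt0); apply: le_trans.
  rewrite objectiveE.
  under eq_bigr do rewrite mxE mulrCA bw.
  by rewrite -mulr_sumr sumrN -sqr_enorm mulrN expr2 mulKf.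
split; first split.
- apply: enorm_eq1; under eq_bigr do rewrite mxE exprMn.
  by rewrite -mulr_sumr -sqr_enorm -exprMn mulVf // expr1n.
- move=> i; rewrite mxE mulr_ge0 ?invr_ge0 ?enorm_ge0 //.
  by have [->|->] := keeps_largest_entry i vw; rewrite ?neg_part_ge0.
- apply: leq_trans (keeps_largest_sparse vw).
  apply: subset_leq_card; apply/fintype.subsetP=> i.
  by rewrite !inE mxE mulf_eq0 negb_or => /andP[].
Qed.

Lemma neg_part_eq0_ge0 b i : neg_part b = 0 -> 0 <= b i 0.
Proof.
by move=> b_neg0; have := neg_part_ge b i; rewrite b_neg0 mxE; lra.
Qed.

Lemma sphere_orthant_le1 x i : sphere x -> orthant x -> x i 0 <= 1.
Proof.
move=> /sum_sqr_sphere x1 x_ge0.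
have : x i 0 ^+ 2 <= 1.
  rewrite -x1 (bigD1 i) //= lerDl.
  by apply: sumr_ge0 => j _; apply: sqr_ge0.
by have := x_ge0 i; nra.
Qed.

(** The comparison is termwise, [b_j0 * x_i ^ 2 <= b_i * x_i], because
    [0 <= b_j0 <= b_i] and [0 <= x_i <= 1]. *)
Lemma optimal_delta_argmin p b j0 :
  (0 < p)%N -> neg_part b = 0 -> argmin b j0 -> optimal p b (delta_mx j0 0).
Proof.
move=> p_gt0 b_neg0 min_j0.
have deltaE i : (delta_mx j0 0 : 'cV[R]_k) i 0 = (i == j0)%:R.
  by rewrite mxE eqxx andbT.
split.
  split; first split.
  - apply: enorm_eq1; rewrite (bigD1 j0) //= deltaE eqxx expr1n big1 ?addr0 //.
    by move=> i /negPf ij0; rewrite deltaE ij0 expr0n.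
  - by move=> i; rewrite deltaE ler0n.
  - apply: leq_trans p_gt0; rewrite -[leqRHS](card1 j0).
    apply: subset_leq_card; apply/fintype.subsetP=> i; rewrite !inE deltaE.
    by case: (i == j0); rewrite ?eqxx.
move=> x [[x_sph x_ge0] _]; rewrite !objectiveE.
rewrite (bigD1 j0) //= deltaE eqxx mulr1 big1 ?addr0; last first.
  by move=> i /negPf ij0; rewrite deltaE ij0 mulr0.
rewrite -[leLHS]mulr1 -(sum_sqr_sphere x_sph) mulr_sumr.
apply: ler_sum => i _.
apply: ler_pM; rewrite ?sqr_ge0 ?neg_part_eq0_ge0 ?min_j0 //.
by rewrite expr2 ler_piMl ?sphere_orthant_le1.
Qed.

Lemma argmin_exists b : (0 < k)%N -> exists j0, argmin b j0.
Proof.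
move=> k_gt0; pose i0 := Ordinal k_gt0.
case: (@arg_minP _ _ _ i0 predT (fun i => b i 0)) => // j0 _ min_j0.
by exists j0 => j; apply: min_j0.
Qed.

End Vectors.

Theorem lemma3p1 (R : realType) (k p : nat) (hk : (1 <= k)%N) (hp : (1 <= p)%N)
    (b : 'cV[R]_k) :
  (exists u : 'cV[R]_k, closed_form p b u) /\
  (forall u : 'cV[R]_k, closed_form p b u -> optimal p b u).
Proof.
rewrite /closed_form; split=> [|u]; case: (eqVneq (neg_part b) 0) => b_neg /=.
- by have [j0 min_j0] := argmin_exists b hk; exists (delta_mx j0 0), j0.
- have [w vw] := keeps_largest_exists p (neg_part b).
  by exists ((enorm w)^-1 *: w), w.
- by move=> [j0 min_j0 ->]; apply: optimal_delta_argmin.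
- by move=> [w vw ->]; apply: optimal_normalized_keeps_largest.
Qed.
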